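(* Let $\kappa$ be an unfoldable cardinal. Then, for any $S\subset \mathcal{R}(\kappa)$ and for every ordinal $\alpha$, the structure $(\mathcal{E}^{wf}_{(\mathcal{R}(\kappa),\in,S)},\prec_e)$ contains chains of order type $\alpha$.
   Context: $\mathcal{R}(\kappa)=V_\kappa$ is the set of all sets of rank less than $\kappa$. A structure $(N,F,\dots)$ end extends $(M,E,\dots)$ if $M\subset N$ and for every $a\in M$, $\{b\in M : bEa\}=\{b\in N: bFa\}$. Write $\mathfrak{A}\prec_e\mathfrak{B}$ if $\mathfrak{B}$ is a proper (non-trivial) end extension of $\mathfrak{A}$ and an elementary extension of $\mathfrak{A}$ in the full language of the structures (including additional predicates); such a $\mathfrak B$ is called an end elementary extension (eee). $\mathcal{E}_{\mathfrak{A}}$ is the class of all eees of $\mathfrak{A}$, ordered by $\prec_e$, and $\mathcal{E}^{wf}_{\mathfrak{A}}$ is the class of those that are well-founded. $o(M)$ denotes the ordinal height of $M$. A cardinal $\kappa$ is unfoldable if it is inaccessible and for every ordinal $\alpha$ and every $S\subset\mathcal{R}(\kappa)$ there is a well-founded $M\in\mathcal{E}_{(\mathcal{R}(\kappa),\in,S)}$ with $o(M)\geq\alpha$. *)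

(* Defs.v *)
From HB Require Import structures.
From mathcomp Require Import all_boot generic_quotient.
From mathcomp Require Import boolp classical_sets functions cardinality.
Set Implicit Arguments.
Unset Strict Implicit.
Unset Printing Implicit Defensive.
Local Open Scope classical_set_scope.
Local Open Scope card_scope.
Local Open Scope quotient_scope.

(* The universe of sets: well-founded trees (Aczel), quotiented by
   bisimilarity so that extensional equality becomes Leibniz equality.
   The lemmas [mem_vset], [vext] and [mem_wf] determine it: the elements of V
   are exactly the extents of families in V indexed by a type of the universe
   of index types, and membership is extensional and well-founded. *)

Inductive ens : Type := Sup (A : Type) of (A -> ens).

Fixpoint ens_eq (x y : ens) {struct x} : Prop :=
  match x, y with
  | Sup A f, Sup B g =>
      (forall a, exists b, ens_eq (f a) (g b)) /\
      (forall b, exists a, ens_eq (f a) (g b))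
  end.

Lemma ens_eq_refl x : ens_eq x x.
Proof. by elim: x => A f IH /=; split=> a; exists a. Qed.

Lemma ens_eq_sym x y : ens_eq x y -> ens_eq y x.
Proof.
elim: x y => A f IH [B g] /= [h1 h2].
by split=> [b|a]; [have [a /IH ?] := h2 b; exists a
                  |have [b /IH ?] := h1 a; exists b].
Qed.

Lemma ens_eq_trans x y z : ens_eq x y -> ens_eq y z -> ens_eq x z.
Proof.
elim: x y z => A f IH [B g] [C k] /= [h1 h2] [h3 h4]; split=> [a|c].
  by have [b hb] := h1 a; have [c hc] := h3 b; exists c; apply: IH hc.
by have [b hb] := h4 c; have [a ha] := h2 b; exists a; apply: IH hb.
Qed.

HB.instance Definition _ := gen_eqMixin ens.
HB.instance Definition _ := gen_choiceMixin ens.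

Definition ens_eqb (x y : ens) : bool := `[< ens_eq x y >].

Lemma ens_eqb_refl : reflexive ens_eqb.
Proof. by move=> x; apply/asboolP/ens_eq_refl. Qed.

Lemma ens_eqb_sym : symmetric ens_eqb.
Proof. by move=> x y; apply/asboolP/asboolP; apply: ens_eq_sym. Qed.

Lemma ens_eqb_trans : transitive ens_eqb.
Proof.
by move=> y x z /asboolP xy /asboolP yz; apply/asboolP/(ens_eq_trans xy).
Qed.

Canonical ens_equiv := EquivRel ens_eqb ens_eqb_refl ens_eqb_sym ens_eqb_trans.

Definition V : Type := {eq_quot ens_equiv}.

Definition toV (x : ens) : V := \pi_{eq_quot ens_equiv} x.
Definition ofV (x : V) : ens := repr (x : {eq_quot ens_equiv}).

Definition idx (x : V) : Type := let: Sup A _ := ofV x in A.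
Definition elt (x : V) : idx x -> V :=
  match ofV x as e return (let: Sup A _ := e in A) -> V with
  | Sup A f => fun a => toV (f a)
  end.

Definition mem (x y : V) : Prop := exists a : idx y, x = elt a.
Notation "x ∈ y" := (mem x y) (at level 70, no associativity).

Definition elts (x : V) : set V := [set u | u ∈ x].
Notation "x ⊆ y" := (elts x `<=` elts y) (at level 70, no associativity).

Definition vset (A : Type) (f : A -> V) : V := toV (Sup (fun a => ofV (f a))).

Lemma ofVK x : toV (ofV x) = x.
Proof. exact: reprK. Qed.

Lemma toV_eq x y : (toV x = toV y) <-> ens_eq x y.
Proof.
rewrite /toV; split=> [/eqmodP /asboolP //|xy].
by apply/eqmodP/asboolP.
Qed.

Lemma ens_eq_toVK x : ens_eq (ofV (toV x)) x.
Proof. by apply/toV_eq; rewrite ofVK. Qed.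

Lemma mem_toV x A (f : A -> ens) :
  x ∈ toV (Sup f) <-> exists a, x = toV (f a).
Proof.
have := ens_eq_toVK (Sup f); rewrite /mem /elt /idx.
case: (ofV _) => B g /= [h1 h2]; split=> [[b ->]|[a ->]].
  by have [a ab] := h1 b; exists a; apply/toV_eq.
by have [b ab] := h2 a; exists b; apply/toV_eq/ens_eq_sym.
Qed.

Lemma mem_vset x A (f : A -> V) : x ∈ vset f <-> exists a, x = f a.
Proof.
by rewrite mem_toV; split=> -[a ->]; exists a; rewrite ofVK.
Qed.

Lemma vext x y : (forall u, u ∈ x <-> u ∈ y) -> x = y.
Proof.
rewrite -(ofVK x) -(ofVK y); case: (ofV x) (ofV y) => A f [B g] h.
apply/toV_eq; split=> [a|b].
  have /mem_toV[b e] : toV (f a) ∈ toV (Sup g) by apply/h/mem_toV; exists a.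
  by exists b; apply/toV_eq.
have /mem_toV[a e] : toV (g b) ∈ toV (Sup f) by apply/h/mem_toV; exists b.
by exists a; apply/toV_eq.
Qed.

Lemma mem_wf : well_founded mem.
Proof.
move=> x; rewrite -(ofVK x); elim: (ofV x) => A f IH.
by constructor=> y /mem_toV[a ->].
Qed.

Definition vsucc (x : V) : V :=
  vset (fun o : option (idx x) => if o is Some a then elt a else x).

Definition vpow (x : V) : V :=
  vset (fun P : idx x -> Prop => vset (fun a : {a | P a} => elt (sval a))).

Definition vbigcup (A : Type) (f : A -> V) : V :=
  vset (fun p : {a : A & idx (f a)} => elt (projT2 p)).

Lemma mem_vsucc x y : x ∈ vsucc y <-> x ∈ y \/ x = y.
Proof.
rewrite mem_vset; split=> [[[a|] ->]|[[a ->]|->]]; first by left; exists a.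
- by right.
- by exists (Some a).
- by exists None.
Qed.

Lemma mem_vpow x y : x ∈ vpow y <-> x ⊆ y.
Proof.
rewrite mem_vset; split=> [[P ->] u /mem_vset[a ->]|xy]; first by exists (sval a).
exists (fun a => elt a ∈ x); apply: vext => u; rewrite mem_vset; split.
  move=> ux; have [a e] := xy u ux; rewrite e in ux.
  by exists (exist _ a ux).
by move=> [[a ax] ->].
Qed.

Lemma mem_vbigcup x A (f : A -> V) : x ∈ vbigcup f <-> exists a, x ∈ f a.
Proof.
rewrite mem_vset; split=> [[[a i] ->]|[a [i ->]]]; first by exists a, i.
by exists (existT _ a i).
Qed.

Fixpoint ens_rank (x : ens) : V :=
  let: Sup A f := x in vbigcup (fun a => vsucc (ens_rank (f a))).
Definition rank (x : V) : V := ens_rank (ofV x).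

Fixpoint ens_R (x : ens) : V :=
  let: Sup A f := x in vbigcup (fun a => vpow (ens_R (f a))).
Definition R (x : V) : V := ens_R (ofV x).

(* For a class E, an "ordinal in the sense of E" is E-transitive and strictly
   linearly ordered by E. Irreflexivity, and the well-ordering property, come
   from Foundation or from the well-foundedness of the structure at hand. *)
Definition ordinal_for (E : V -> V -> Prop) (a : V) : Prop :=
  (forall x y, E x a -> E y x -> E y a) /\
  (forall x y, E x a -> E y a -> E x y \/ x = y \/ E y x).

Definition is_ordinal (a : V) : Prop := ordinal_for mem a.

Lemma toV_ind (P : V -> Prop) : (forall x, P (toV x)) -> forall x, P x.
Proof. by move=> h x; rewrite -(ofVK x). Qed.

Lemma ens_rank_eq x y : ens_eq x y -> ens_rank x = ens_rank y.
Proof.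
elim: x y => A f IH [B g] /= [h1 h2]; apply: vext => u; rewrite !mem_vbigcup.
split=> -[].
  by move=> a; have [b /IH ->] := h1 a; exists b.
by move=> b; have [a /IH <-] := h2 b; exists a.
Qed.

Lemma mem_rank u x : u ∈ rank x <-> exists y, y ∈ x /\ (u ∈ rank y \/ u = rank y).
Proof.
have rk e : rank (toV e) = ens_rank e by apply/ens_rank_eq/ens_eq_toVK.
elim/toV_ind: x => -[A f]; rewrite rk /= mem_vbigcup; split.
  move=> [a /mem_vsucc ?]; exists (toV (f a)); rewrite rk; split=> //.
  by apply/mem_toV; exists a.
by move=> [y [/mem_toV[a ->]]]; rewrite rk => h; exists a; apply/mem_vsucc.
Qed.

Lemma ens_R_eq x y : ens_eq x y -> ens_R x = ens_R y.
Proof.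
elim: x y => A f IH [B g] /= [h1 h2]; apply: vext => u; rewrite !mem_vbigcup.
split=> -[].
  by move=> a; have [b /IH ->] := h1 a; exists b.
by move=> b; have [a /IH <-] := h2 b; exists a.
Qed.

Lemma mem_R u x : u ∈ R x <-> exists y, y ∈ x /\ u ⊆ R y.
Proof.
have rk e : R (toV e) = ens_R e by apply/ens_R_eq/ens_eq_toVK.
elim/toV_ind: x => -[A f]; rewrite rk /= mem_vbigcup; split.
  move=> [a /mem_vpow ?]; exists (toV (f a)); rewrite rk; split=> //.
  by apply/mem_toV; exists a.
by move=> [y [/mem_toV[a ->]]]; rewrite rk => h; exists a; apply/mem_vpow.
Qed.

Lemma mem_irr x : ~ x ∈ x.
Proof. by elim/(well_founded_ind mem_wf): x => x IH xx; apply: (IH x xx). Qed.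

Lemma mem_asym x y : x ∈ y -> ~ y ∈ x.
Proof.
elim/(well_founded_ind mem_wf): x y => x IH y xy yx.
exact: (IH y yx x yx xy).
Qed.

Lemma mem_acyc3 x y z : x ∈ y -> y ∈ z -> ~ z ∈ x.
Proof.
elim/(well_founded_ind mem_wf): x y z => x IH y z xy yz zx.
exact: (IH z zx x y zx xy yz).
Qed.

Lemma ordinal_mem a b : is_ordinal a -> b ∈ a -> is_ordinal b.
Proof.
move=> [ta la] ba; split=> [x y xb yx|x y xb yb].
  have xa := ta _ _ ba xb; have ya := ta _ _ xa yx.
  case: (la y b ya ba) => [//|[yb|by_]].
    by rewrite yb in yx; case: (mem_asym xb yx).
  by case: (mem_acyc3 yx xb by_).
by apply: la; [apply: ta xb|apply: ta yb].
Qed.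

Lemma ordinal_ltP a b : is_ordinal a -> is_ordinal b ->
  a ∈ b \/ a = b \/ b ∈ a.
Proof.
elim/(well_founded_ind mem_wf): a b => a IHa.
elim/(well_founded_ind mem_wf) => b IHb oa ob.
have [[c [cb ca]]|h1] := pselect (exists c, c ∈ b /\ ~ c ∈ a).
  have [h|[h|h]] := IHb c cb oa (ordinal_mem ob cb).
  - by left; apply: ob.1 cb h.
  - by left; rewrite h.
  - by [].
have [[c [ca cb]]|h2] := pselect (exists c, c ∈ a /\ ~ c ∈ b).
  have [h|[h|h]] := IHa c ca b (ordinal_mem oa ca) ob.
  - by [].
  - by right; right; rewrite -h.
  - by right; right; apply: oa.1 ca h.
right; left; apply: vext => u; split=> hu; apply: contrapT => nu.
  by apply: h2; exists u.
by apply: h1; exists u.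
Qed.

Lemma ordinal_rank x : is_ordinal (rank x).
Proof.
elim/(well_founded_ind mem_wf): x => x IH; split=> [u v|u v].
  move=> /mem_rank[y [yx uy]] vu; apply/mem_rank; exists y; split=> //; left.
  by case: uy => [uy|uy]; [apply: (IH y yx).1 uy vu|rewrite -uy].
have o w : w ∈ rank x -> is_ordinal w.
  by move=> /mem_rank[y [yx [wy|->]]]; [apply: ordinal_mem wy|]; apply: IH.
by move=> /o ou /o ov; apply: ordinal_ltP.
Qed.

(* [R k] is the set of all sets of rank less than [k]. *)
Lemma mem_R_rank k x : is_ordinal k -> x ∈ R k <-> rank x ∈ k.
Proof.
elim/(well_founded_ind mem_wf): k x => k IH x ok; rewrite mem_R; split.
  move=> [b [bk xb]]; have ob := ordinal_mem ok bk.
  have [h|[h|h]] := ordinal_ltP (ordinal_rank x) ob.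
  - exact: ok.1 bk h.
  - by rewrite h.
  case/mem_rank: h => y [yx by_]; have /(IH b bk y ob) yb := xb y yx.
  case: by_ => [by_|e]; first by case: (mem_irr (ob.1 _ _ yb by_)).
  by rewrite -e in yb; case: (mem_irr yb).
move=> xk; exists (rank x); split=> // y yx.
apply/(IH _ xk _ (ordinal_rank x)); apply/mem_rank; exists y.
by split=> //; right.
Qed.

Definition card_lt (A B : set V) : Prop := (A #<= B) /\ ~ (B #<= A).

Definition is_cardinal (k : V) : Prop :=
  is_ordinal k /\ forall b, b ∈ k -> card_lt (elts b) (elts k).

Definition regular (k : V) : Prop :=
  forall (b : V) (f : V -> V), b ∈ k ->
    (forall x, x ∈ b -> f x ∈ k) ->
    exists c, c ∈ k /\ forall x, x ∈ b -> f x ∈ c.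

Definition strong_limit (k : V) : Prop :=
  forall b, b ∈ k -> card_lt (elts (vpow b)) (elts k).

Definition inaccessible (k : V) : Prop :=
  is_cardinal k /\ ~ countable (elts k) /\ regular k /\ strong_limit k.

Record structure := Structure {
  carrier : V;
  srel : V -> V -> Prop;
  spred : V -> Prop;
  srel_carrier : forall x y, srel x y -> x ∈ carrier /\ y ∈ carrier;
  spred_carrier : forall x, spred x -> x ∈ carrier
}.

Program Definition mem_structure (M S : V) : structure :=
  {| carrier := M;
     srel := fun x y => x ∈ M /\ y ∈ M /\ x ∈ y;
     spred := fun x => x ∈ M /\ x ∈ S |}.

(* First-order formulas of the language of [structure], with de Bruijn
   indices: [FEx] binds index 0. *)
Inductive formula : Type :=
| FEq of nat & nat
| FMem of nat & nat
| FPred of nat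
| FNot of formula
| FAnd of formula & formula
| FEx of formula.

Definition scons (x : V) (s : nat -> V) (i : nat) : V :=
  if i is j.+1 then s j else x.

Fixpoint sat (A : structure) (p : formula) (s : nat -> V) : Prop :=
  match p with
  | FEq i j => s i = s j
  | FMem i j => srel A (s i) (s j)
  | FPred i => spred A (s i)
  | FNot q => ~ sat A q s
  | FAnd q r => sat A q s /\ sat A r s
  | FEx q => exists x, x ∈ carrier A /\ sat A q (scons x s)
  end.

Definition end_extension (A B : structure) : Prop :=
  carrier A ⊆ carrier B /\
  forall a, a ∈ carrier A ->
    [set b | b ∈ carrier A /\ srel A b a] = [set b | b ∈ carrier B /\ srel B b a].

Definition elementary_extension (A B : structure) : Prop :=
  carrier A ⊆ carrier B /\
  forall (p : formula) (s : nat -> V), (forall i, s i ∈ carrier A) ->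
    (sat A p s <-> sat B p s).

Definition prec_e (A B : structure) : Prop :=
  [/\ end_extension A B, carrier A <> carrier B & elementary_extension A B].
Notation "A ≺ₑ B" := (prec_e A B) (at level 70, no associativity).

Definition eee (A : structure) : set structure := [set B | A ≺ₑ B].

Definition wf_structure (A : structure) : Prop := well_founded (srel A).

Definition eee_wf (A : structure) : set structure :=
  [set B | eee A B /\ wf_structure B].

Definition order_iso (T U : Type) (A : set T) (lA : T -> T -> Prop)
    (B : set U) (lB : U -> U -> Prop) : Prop :=
  exists f : T -> U, set_bij A B f /\
    forall x y, A x -> A y -> (lA x y <-> lB (f x) (f y)).

(* [t] is the ordinal height o(A): the order type of the ordinals of [A].
   For transitive [A] whose relation is membership these are the ordinals in
   the carrier of [A]. *)
Definition ordinals (A : structure) : set V :=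
  [set a | a ∈ carrier A /\ ordinal_for (srel A) a].

Definition is_height (A : structure) (t : V) : Prop :=
  is_ordinal t /\ order_iso (elts t) mem (ordinals A) (srel A).

Definition unfoldable (k : V) : Prop :=
  inaccessible k /\
  forall a S : V, is_ordinal a -> S ⊆ R k ->
    exists M : structure,
      eee (mem_structure (R k) S) M /\ wf_structure M /\
      exists t, is_height M t /\ (a ∈ t \/ a = t).

(* [(K, l)] contains a chain of order type [a]; linearity of [C] under [l]
   is part of the isomorphism with [a]. *)
Definition contains_chain (T : Type) (K : set T) (l : T -> T -> Prop) (a : V) :
    Prop :=
  exists C : set T, C `<=` K /\ order_iso (elts a) mem C l.

(* Main.v *)
From HB Require Import structures.
From mathcomp Require Import all_boot.
From mathcomp Require Import boolp classical_sets functions cardinality.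
Require Import Defs.

(** Below an inaccessible [k], the ordinals [l] whose level [R l] reflects the
    structure [(R k, S)] are unbounded ([unbounded_reflects], a
    Löwenheim-Skolem argument). Hence there is an increasing sequence of
    reflecting levels, indexed by the ordinals below [k], and through the rank
    by all [b] in [R k]: [U b = R (e (rank b))], with [b ∈ U b].

    Unfoldability is applied to a single predicate [T] which codes both [S] and
    this sequence: the unordered pairs [{x, x}] for [x] in [S] and [{b, U b}]
    for [b] in [R k] ([exists_levelled]). The properties that matter, namely
    that every [b] has a level, that levels increase with [b], that they are
    transitive, and that each of them is an elementary substructure, form a set
    of first-order sentences about [(R k, T)] ([levelled]). So they hold in
    every elementary extension [M] of [(R k, T)] ([levelled_elementary]). In a
    well-founded [M], the levels of elements [b] lying outside [R k] are end
    elementary extensions of [(R k, S)] ([prec_e_base]), and these levels are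
    end elementary extensions of one another in the order of their indices
    ([prec_e_level]).

    It remains to have enough indices. The isomorphism [f] between the height
    [t] of [M] and the ordinals of [M] fixes every [c] whose image lies in
    [R k] ([height_fixes_R]), so that [f c] lies outside [R k] once [k] is
    included in [c]. If the height of [M] is at least the ordinal sum [k + a],
    then the levels of [f (k + x)], for [x] in [a], form the chain. *)

Set Implicit Arguments.
Unset Strict Implicit.
Unset Printing Implicit Defensive.
Local Open Scope classical_set_scope.
Local Open Scope card_scope.

(** * Recursion and injections *)

(** Recursion on membership in which each value is chosen subject to a condition
    on the set of the previous values; a condition that cannot be satisfied
    is dropped, which lets a construction run past the point where it stops. *)
Lemma wf_choice (T : Type) (x0 : T) (P : V -> set T -> T -> Prop) :
  exists e : V -> T, forall b, (exists a, P b (e @` elts b) a) ->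
    P b (e @` elts b) (e b).
Proof.
pose step b D := if pselect (exists a, P b D a) is left h
  then projT1 (cid h) else x0.
pose F b (e : forall c, c ∈ b -> T) :=
  step b [set a | exists c (h : c ∈ b), e c h = a].
pose e := Fix mem_wf (fun=> T) F; exists e => b.
have -> : e b = step b (e @` elts b).
  rewrite /e Fix_eq; last first.
    move=> x f g fg; congr step; apply/seteqP.
    by split=> _ [c [h <-]]; exists c, h; rewrite fg.
  congr step; apply/seteqP; split=> a.
    by move=> [c [h <-]]; exists c.
  by move=> [c h <-]; exists c, h.
by rewrite /step; case: pselect => // h _; case: cid.
Qed.

Lemma card_le_inj (T U : Type) (A : set T) (B : set U) (f : T -> U) :
  (forall x, A x -> B (f x)) ->
  (forall x y, A x -> A y -> f x = f y -> x = y) -> A #<= B.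
Proof.
move=> h1 h2; suff [g] : $|{injfun A >-> B}| by apply: inj_card_le g.
by apply/injfunPex; exists f => // x y /set_mem ? /set_mem ?; apply: h2.
Qed.

Lemma card_le_injP (T : Type) (A : set T) (B : set V) : A #<= B ->
  exists f : T -> V, (forall x, A x -> B (f x)) /\
    forall x y, A x -> A y -> f x = f y -> x = y.
Proof.
pose V' := isPointed.Build V (toV (Sup (fun x : False => match x with end))).
pose PV : pointedType := HB.pack V (gen_eqMixin V) (gen_choiceMixin V) V'.
move=> /(@pcard_leP _ PV)/injfunPex[f h1 h2]; exists f; split=> // x y ? ?.
by apply: h2; apply/mem_set.
Qed.

(** * Bounded families below a regular cardinal *)

Definition unbounded (k : V) (A : set V) : Prop :=
  A `<=` elts k /\ forall c, c ∈ k -> exists2 a, A a & c ∈ a.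

(** For inaccessible [k] this amounts to having fewer than [k] elements, but
    this form is stable under unions, products and images for immediate
    reasons. *)
Definition small (k : V) (T : Type) (X : set T) : Prop :=
  forall f : T -> V, (forall x, X x -> f x ∈ k) ->
    exists2 c, c ∈ k & forall x, X x -> f x ∈ c.

Lemma inaccessible_neq0 (k : V) : inaccessible k -> exists c, c ∈ k.
Proof.
move=> ik; apply: contrapT => nk; case: (ik.2.1).
apply: (@card_le_inj _ _ _ _ (fun=> 0%N)) => // x y xk.
by case: nk; exists x.
Qed.

(** A nonempty [b] in [k] exists because [k] is uncountable; regularity, applied to
    the constant function [c] on [b], then gives an element of [k] above [c]. *)
Lemma inaccessible_limit (k c : V) : inaccessible k -> c ∈ k ->
  exists2 d, d ∈ k & c ∈ d.
Proof.
move=> [[[tk lk] _] [uk [rk _]]] ck.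
have [[b [bk [z zb]]]|h] := pselect (exists b, b ∈ k /\ exists z, z ∈ b).
  by have [|d [dk h]] := rk b (fun=> c) bk => //; exists d => //; apply: h zb.
case: uk; apply: (@card_le_inj _ _ _ _ (fun=> 0%N)) => // x y xk yk _.
have [xy|[//|yx]] := lk x y xk yk; case: h.
  by exists y; split=> //; exists x.
by exists x; split=> //; exists y.
Qed.

Lemma join_ordinal (k b c : V) : inaccessible k -> b ∈ k -> c ∈ k ->
  exists d, [/\ d ∈ k, b ∈ d & c ∈ d].
Proof.
move=> ik bk ck; have [[tk lk] _] := ik.1.
have [b' b'k bb'] := inaccessible_limit ik bk.
have [c' c'k cc'] := inaccessible_limit ik ck.
have [h|[h|h]] := lk b' c' b'k c'k.
- exists c'; split=> //.
  by apply: (ordinal_mem (conj tk lk) c'k).1 bb'.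
- by exists c'; split=> //; rewrite -h.
- exists b'; split=> //.
  by apply: (ordinal_mem (conj tk lk) b'k).1 cc'.
Qed.

(** At stage [b] the previous values are bounded in [k] by regularity, so that [A]
    has an element above all of them and above [b]. *)
Lemma unbounded_enum (k : V) (A : set V) : inaccessible k -> unbounded k A ->
  exists e : V -> V, forall b, b ∈ k ->
    [/\ A (e b), b ∈ e b & forall c, c ∈ b -> e c ∈ e b].
Proof.
move=> ik [Ak Au]; have [[tk lk] _] := ik.1; have [_ [rk _]] := ik.2.
have [e he] := wf_choice k (fun b D a => [/\ A a, b ∈ a & forall x, D x -> x ∈ a]).
exists e; elim/(well_founded_ind mem_wf) => b IH bk.
have ek c : c ∈ b -> e c ∈ k.
  by move=> cb; have [/Ak] := IH c cb (tk _ _ bk cb).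
have [d [dk hd]] := rk b e bk ek.
have [d' [d'k dd' bd']] := join_ordinal ik dk bk.
have [a Aa d'a] := Au d' d'k.
have oa : is_ordinal a := ordinal_mem (conj tk lk) (Ak _ Aa).
have [|h1 h2 h3] := he b.
  exists a; split=> //; first by apply: oa.1 bd'.
  move=> _ [c cb <-]; apply: (oa.1 d) (hd _ cb).
  exact: oa.1 dd'.
by split=> // c cb; apply: h3; exists c.
Qed.

(** The image of an unbounded [f] would contain an increasing [k]-sequence, and
    preimages of its terms would inject [k] into [X]. *)
Lemma not_card_le_small (k : V) (T : Type) (X : set T) :
  inaccessible k -> ~ (elts k #<= X) -> small k X.
Proof.
move=> ik nkX f fk; apply: contrapT => nb; apply: nkX.
have [[tk lk] _] := ik.1.
have u : unbounded k (f @` X).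
  split=> [_ [x Xx <-]|c ck]; first exact: fk.
  apply: contrapT => h; apply: nb.
  have [d dk cd] := inaccessible_limit ik ck.
  exists d => // x Xx; have [xc|[xc|cx]] := lk (f x) c (fk _ Xx) ck.
  - by apply: (ordinal_mem (conj tk lk) dk).1 xc.
  - by rewrite xc.
  - by case: h; exists (f x) => //; exists x.
have [e he] := unbounded_enum ik u.
have /choice[g hg] : forall b, exists x, b ∈ k -> X x /\ f x = e b.
  have [b ck] := inaccessible_neq0 ik.
  have [[x0 _ _] _ _] := he b ck => b'.
  have [b'k|] := pselect (b' ∈ k); last by exists x0.
  by have [[x Xx xe] _ _] := he b' b'k; exists x.
apply: (card_le_inj (f := g)) => [b /hg[]//|b c bk ck bc].
have ebc : e b = e c by rewrite -(hg b bk).2 -(hg c ck).2 bc.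
have [h|[//|h]] := lk b c bk ck.
  by have [_ _ /(_ _ h)] := he c ck; rewrite ebc => /mem_irr.
by have [_ _ /(_ _ h)] := he b bk; rewrite ebc => /mem_irr.
Qed.

(** Choose elements of [X] one after the other, without repetition. If this went on
    through all stages below [k], the inverse of the enumeration would be an
    unbounded function from [X] to [k]; so [X] is exhausted at some stage
    [b], which counts it. *)
Lemma small_card_le (k : V) (T : Type) (X : set T) :
  inaccessible k -> small k X -> exists2 c, c ∈ k & X #<= elts c.
Proof.
move=> ik sX; have [[tk lk] _] := ik.1.
have [[x0 Xx0]|nX] := pselect (exists x, X x); last first.
  have [c ck] := inaccessible_neq0 ik.
  exists c => //; apply: (@card_le_inj _ _ _ _ (fun=> c)) => [x Xx|x y Xx].
    by case: nX; exists x.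
  by case: nX; exists x.
have [e he] := wf_choice x0 (fun b D a => X a /\ ~ D a).
have [[b [bk hb]]|h] :=
  pselect (exists b, b ∈ k /\ forall x, X x -> (e @` elts b) x).
  exists b => //.
  have /choice[g hg] : forall x, exists c, X x -> c ∈ b /\ e c = x.
    move=> x; have [/hb[c cb ce]|] := pselect (X x); last by exists b.
    by exists c.
  apply: (card_le_inj (f := g)) => [x /hg[]//|x y /hg[_ gx] /hg[_ gy] xy].
  by rewrite -gx -gy xy.
have he' b : b ∈ k -> X (e b) /\ ~ (e @` elts b) (e b).
  move=> bk; apply: he; apply: contrapT => h'; apply: h; exists b; split=> // x Xx.
  by apply: contrapT => ?; apply: h'; exists x.
have inj b c : b ∈ k -> c ∈ k -> e b = e c -> b = c.
  move=> bk ck bc; have [h1|[//|h1]] := lk b c bk ck.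
    by case: (he' c ck) => _ []; exists b.
  by case: (he' b bk) => _ []; exists c.
have [c0 c0k] := inaccessible_neq0 ik.
have /choice[g hg] : forall x, exists b, b ∈ k /\
    (forall b', b' ∈ k -> e b' = x -> b = b').
  move=> x; have [[b [bk eb]]|n] := pselect (exists b, b ∈ k /\ e b = x).
    by exists b; split=> // b' b'k eb'; apply: inj => //; rewrite eb.
  by exists c0; split=> // b' b'k eb'; case: n; exists b'.
have [c ck hc] := sX g (fun x _ => (hg x).1).
have := hc _ (he' c ck).1; rewrite ((hg _).2 c ck) // => /mem_irr //.
Qed.

Lemma small_image (k : V) (T U : Type) (X : set T) (g : T -> U) :
  small k X -> small k (g @` X).
Proof.
move=> sX f fk; have [|c ck hc] := sX (f \o g) => [x Xx|].
  by apply: fk; exists x.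
by exists c => // _ [x Xx <-]; apply: hc.
Qed.

Lemma small_subset (k : V) (T : Type) (X Y : set T) : inaccessible k ->
  X `<=` Y -> small k Y -> small k X.
Proof.
move=> ik XY sY f fk; have [c0 c0k] := inaccessible_neq0 ik.
have [|c ck hc] := sY (fun x => if pselect (X x) is left _ then f x else c0).
  by move=> x _; case: pselect => [/fk|].
by exists c => // x Xx; have := hc x (XY x Xx); case: pselect.
Qed.

Lemma small_bigcup (k : V) (I T : Type) (J : set I) (X : I -> set T) :
  inaccessible k -> small k J -> (forall i, J i -> small k (X i)) ->
  small k (\bigcup_(i in J) X i).
Proof.
move=> ik sJ sX f fk; have [[tk lk] _] := ik.1.
have /choice[g hg] : forall i, exists c,
    J i -> c ∈ k /\ forall x, X i x -> f x ∈ c.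
  move=> i; have [Ji|] := pselect (J i); last by exists k.
  have [|c ck hc] := sX i Ji f => [x Xx|]; last by exists c.
  by apply: fk; exists i.
have [c ck hc] := sJ g (fun i Ji => (hg i Ji).1).
exists c => // x [i Ji Xx].
by apply: (ordinal_mem (conj tk lk) ck).1 (hc _ Ji) ((hg i Ji).2 x Xx).
Qed.

Lemma small_elts (k c : V) : inaccessible k -> c ∈ k -> small k (elts c).
Proof.
move=> ik ck f fk; have [_ [rk _]] := ik.2.
by have [d [dk hd]] := rk c f ck fk; exists d.
Qed.

(** [X] injects into some [c] in [k], hence its subsets inject into the powerset of
    [c], and [k] is a strong limit. *)
Lemma small_subsets (k : V) (X : set V) : inaccessible k -> small k X ->
  small k [set u | elts u `<=` X].
Proof.
move=> ik sX; have [c ck cX] := small_card_le ik sX.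
have [_ nlk] := ik.2.2.2 c ck.
suff uc : [set u | elts u `<=` X] #<= elts (vpow c).
  apply: (not_card_le_small ik) => h.
  by apply: nlk; apply: card_le_trans uc.
have [f [fc finj]] := card_le_injP cX.
(* [F u] is the image of the set [u] under [f]. *)
pose F u := vset (fun a : idx u => f (elt a)).
have inF u y : y ∈ F u <-> exists x, x ∈ u /\ y = f x.
  rewrite mem_vset; split=> [[a ->]|[_ [[a ->] ->]]].
    by exists (elt a); split=> //; exists a.
  by exists a.
apply: (card_le_inj (f := F)) => [u uX|u v uX vX uv].
  by apply/mem_vpow => y /inF[x [/uX xX ->]]; apply: fc.
have sub u' v' : elts u' `<=` X -> elts v' `<=` X -> F u' = F v' ->
    forall x, x ∈ u' -> x ∈ v'.
  move=> uX' vX' uv' x xu'; have /inF[y [yv' xy]] : f x ∈ F v'.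
    by rewrite -uv'; apply/inF; exists x.
  by rewrite (finj x y) //; [apply: uX'|apply: vX'].
by apply: vext => x; split; apply: sub.
Qed.

(** The level [R c] is the union, over [b] in [c], of the powersets of the levels
    [R b]. *)
Lemma small_R (k c : V) : inaccessible k -> c ∈ k -> small k (elts (R c)).
Proof.
move=> ik; have [[tk lk] _] := ik.1.
elim/(well_founded_ind mem_wf): c => c IH ck.
have -> : elts (R c) = \bigcup_(b in elts c) [set u | u ⊆ R b].
  apply/seteqP; split=> u; first by move=> /mem_R[b [bc ub]]; exists b.
  by move=> [b bc ub]; apply/mem_R; exists b.
apply: small_bigcup => // [|b bc]; first exact: small_elts.
by apply: small_subsets => //; apply: IH => //; apply: tk bc.
Qed.

Lemma small_countType (k : V) (T : countType) : inaccessible k -> small k [set: T].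
Proof.
move=> ik; have [uk _] := ik.2.
have sN : small k [set: nat] by apply: not_card_le_small.
have [c ck] := inaccessible_neq0 ik.
move=> f fk; pose g n := if unpickle n is Some x then f x else c.
have [|d dk hd] := sN g.
  by rewrite /g => n _; case: (unpickle n) => [x|//]; apply: fk.
by exists d => // x _; have := hd (pickle x) I; rewrite /g pickleK.
Qed.

(** * Formulas *)

(** Formulas are countably many because they embed into trees labelled by natural
    numbers. *)
Fixpoint formula_tree (p : formula) : GenTree.tree nat :=
  match p with
  | FEq i j => GenTree.Node 0 [:: GenTree.Leaf i; GenTree.Leaf j]
  | FMem i j => GenTree.Node 1 [:: GenTree.Leaf i; GenTree.Leaf j]
  | FPred i => GenTree.Leaf i
  | FNot q => GenTree.Node 2 [:: formula_tree q]
  | FAnd q r => GenTree.Node 3 [:: formula_tree q; formula_tree r]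
  | FEx q => GenTree.Node 4 [:: formula_tree q]
  end.

Lemma formula_tree_inj : injective formula_tree.
Proof.
elim=> [i j|i j|i|q IH|q IHq r IHr|q IH] [i' j'|i' j'|i'|q'|q' r'|q'] //=.
- by case=> -> ->.
- by case=> -> ->.
- by case=> ->.
- by case=> /IH->.
- by case=> /IHq-> /IHr->.
- by case=> /IH->.
Qed.

Lemma small_formula (k : V) : inaccessible k -> small k [set: formula].
Proof.
move=> ik f fk; have [c ck] := inaccessible_neq0 ik.
have /choice[g hg] : forall t, exists p, forall q, formula_tree q = t -> p = q.
  move=> t; have [[p pt]|n] := pselect (exists p, formula_tree p = t).
    by exists p => q qt; apply: formula_tree_inj; rewrite pt.
  by exists (FEq 0 0) => q qt; case: n; exists q.
have [|d dk hd] := small_countType (T := GenTree.tree nat) ik (f := f \o g).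
  by move=> t _; apply: fk.
by exists d => // p _; have := hd (formula_tree p) I; rewrite /= (hg _ p).
Qed.

(** All free variables of [p] have an index below [fbound p]. *)
Fixpoint fbound (p : formula) : nat :=
  match p with
  | FEq i j | FMem i j => maxn i.+1 j.+1
  | FPred i => i.+1
  | FNot q => fbound q
  | FAnd q r => maxn (fbound q) (fbound r)
  | FEx q => (fbound q).-1
  end.

Lemma sat_fbound (A : structure) (p : formula) (s t : nat -> V) :
  (forall i, i < fbound p -> s i = t i) -> sat A p s <-> sat A p t.
Proof.
elim: p s t => [i j|i j|i|q IH|q IHq r IHr|q IH] s t /= h.
- by rewrite !h // leq_max ltnSn ?orbT.
- by rewrite !h // leq_max ltnSn ?orbT.
- by rewrite h.
- by rewrite (IH s t).
- rewrite (IHq s t) ?(IHr s t) // => i ir; apply: h; rewrite leq_max ir ?orbT //.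
- have e x : sat A q (scons x s) <-> sat A q (scons x t).
    apply: IH => -[//|i] iq /=; apply: h.
    by rewrite -ltnS (ltn_predK iq).
  by split=> -[x [xA /e]]; exists x.
Qed.

(** Eventually constant assignments stand for finite tuples of parameters from
    [X]. *)
Definition assign (d : V) (X : set V) : set (nat -> V) :=
  [set s | (forall i, X (s i)) /\ exists n, forall i, n <= i -> s i = d].

(** An assignment that is constant from [n.+1] on is obtained by consing an element
    of [X] to one that is constant from [n] on. *)
Lemma small_assign (k d : V) (X : set V) : inaccessible k -> small k X ->
  small k (assign d X).
Proof.
move=> ik sX.
pose S n := [set s : nat -> V | (forall i, X (s i)) /\ forall i, n <= i -> s i = d].
have -> : assign d X = \bigcup_(n in [set: nat]) S n.
  apply/seteqP; split=> s; first by move=> [h [n hn]]; exists n.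
  by move=> [n _ [h hn]]; split=> //; exists n.
apply: small_bigcup => // [|n _]; first exact: small_countType.
elim: n => [|n IH].
  move=> f fk; have [[s0 Ss0]|n] := pselect (exists s, S 0 s); last first.
    have [c ck] := inaccessible_neq0 ik; exists c => // s Ss.
    by case: n; exists s.
  have [c ck hc] := inaccessible_limit ik (fk _ Ss0).
  exists c => // s Ss; suff -> : s = s0 by [].
  by apply/funext => i; rewrite Ss.2 // Ss0.2.
have : small k (\bigcup_(x in X) (scons x @` S n)).
  by apply: small_bigcup => // x Xx; apply: small_image.
apply: small_subset => // s [sX' hs]; exists (s 0%N) => //; exists (fun i => s i.+1).
  by split=> // i ni; apply: hs.
by apply/funext => -[|i].
Qed.

(** * Reflection *)

Definition vsep (x : V) (P : V -> Prop) : V :=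
  vset (fun a : {a : idx x | P (elt a)} => elt (sval a)).

Lemma mem_vsep x P u : u ∈ vsep x P <-> u ∈ x /\ P u.
Proof.
rewrite mem_vset; split=> [[[a Pa] ->]|[[a ->] Pa]]; first by split=> //; exists a.
by exists (exist _ a Pa).
Qed.

#[local] Obligation Tactic := idtac.

Program Definition restrict (A : structure) (u : V) : structure :=
  {| carrier := vsep (carrier A) (fun x => srel A x u);
     srel := fun x y => srel A x u /\ srel A y u /\ srel A x y;
     spred := fun x => srel A x u /\ spred A x |}.
Next Obligation.
move=> A u x y [xu [yu _]]; rewrite !mem_vsep.
by have [? _] := srel_carrier xu; have [? _] := srel_carrier yu.
Qed.
Next Obligation.
by move=> A u x [xu _]; rewrite mem_vsep; have [? _] := srel_carrier xu.
Qed.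

Definition reflects (A : structure) (u : V) : Prop :=
  forall p s, (forall i, srel A (s i) u) -> sat (restrict A u) p s <-> sat A p s.

Lemma R_mono (b c : V) : is_ordinal c -> b ∈ c -> R b ⊆ R c.
Proof.
move=> oc bc x /mem_R[y [yb xy]]; apply/mem_R; exists y; split=> //.
exact: oc.1 bc yb.
Qed.

Lemma R_mem (b c : V) : b ∈ c -> R b ∈ R c.
Proof. by move=> bc; apply/mem_R; exists b; split=> // x. Qed.

Lemma R_trans (c x y : V) : is_ordinal c -> x ∈ R c -> y ∈ x -> y ∈ R c.
Proof.
by move=> oc /mem_R[b [bc xb]] /xb; apply: (R_mono oc bc).
Qed.

(** One step of the Löwenheim-Skolem construction: the ranks of chosen witnesses
    for all formulas with parameters in [R c] are bounded in [k], since there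
    are few such formulas and parameters. *)
Lemma witnesses_bounded (k d c : V) (A : structure) : inaccessible k -> c ∈ k ->
  carrier A = R k ->
  exists e, [/\ e ∈ k, c ∈ e & forall p s, assign d (elts (R c)) s ->
    (exists x, x ∈ carrier A /\ sat A p (scons x s)) ->
    exists x, x ∈ R e /\ sat A p (scons x s)].
Proof.
move=> ik ck Ak; have ok := ik.1.1.
have /choice[w hw] : forall q : formula * (nat -> V), exists x, x ∈ R k /\
    ((exists x, x ∈ carrier A /\ sat A q.1 (scons x q.2)) ->
     sat A q.1 (scons x q.2)).
  move=> q; have [[x [xA xq]]|n] := pselect (exists x, x ∈ carrier A /\
      sat A q.1 (scons x q.2)); first by exists x; rewrite -Ak.
  by exists (R c); split; [exact: R_mem|].
have : small k (\bigcup_(p in [set: formula]) (pair p @` assign d (elts (R c)))).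
  apply: small_bigcup => // [|p _]; first exact: small_formula.
  by apply: small_image; apply: small_assign => //; apply: small_R.
move=> /(_ (rank \o w)) [q _|e ek he].
  by apply/mem_R_rank => //; apply: (hw q).1.
have [e' [e'k ee' ce']] := join_ordinal ik ek ck.
exists e'; split=> // p s As xA; exists (w (p, s)); split; last exact: (hw (p, s)).2.
have oe' := ordinal_mem ok e'k.
apply/mem_R_rank => //; apply: (oe'.1 e) => //; apply: (he (p, s)).
by exists p => //; exists s.
Qed.

(** Iterating [witnesses_bounded] [omega] times above [c] yields a level closed
    under witnesses, which reflects [A] by the Tarski-Vaught criterion. *)
Lemma unbounded_reflects (k : V) (A : structure) : inaccessible k ->
  carrier A = R k -> (forall x y, srel A x y <-> [/\ x ∈ R k, y ∈ R k & x ∈ y]) ->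
  unbounded k [set l | l ∈ k /\ reflects A (R l)].
Proof.
move=> ik Ak Ar; have ok := ik.1.1; split=> [l []//|c ck].
have [c1 c1k cc1] := inaccessible_limit ik ck.
(* The value of all but finitely many variables; it belongs to every level used
   below. *)
pose d := R c.
have /choice[F hF] : forall b, exists e, b ∈ k ->
    [/\ e ∈ k, b ∈ e & forall p s, assign d (elts (R b)) s ->
    (exists x, x ∈ carrier A /\ sat A p (scons x s)) ->
    exists x, x ∈ R e /\ sat A p (scons x s)].
  move=> b; have [bk|] := pselect (b ∈ k); last by exists b.
  by have [e he] := witnesses_bounded d ik bk Ak; exists e.
pose g n := iter n F c1.
have gk n : g n ∈ k by elim: n => //= n /hF[].
have gS n : g n ∈ g n.+1 by have [] := hF _ (gk n).
have og n : is_ordinal (g n) := ordinal_mem ok (gk n).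
have gm m n : m <= n -> R (g m) ⊆ R (g n).
  move=> /subnK <-; elim: (n - m)%N => [//|j IH] x /IH.
  by rewrite addSn; apply: (R_mono (og _) (gS _)).
(* The supremum of the [g n], still in [k] because countable sets are small. *)
pose l := vbigcup g.
have inl x : x ∈ l <-> exists n, x ∈ g n by rewrite mem_vbigcup.
have ol : is_ordinal l.
  split=> x y /inl[n xn].
    by move=> yx; apply/inl; exists n; apply: (og n).1 yx.
  move=> /inl[m ym]; apply: ordinal_ltP; first exact: ordinal_mem xn.
  exact: ordinal_mem ym.
have lk : l ∈ k.
  have [e ek he] := small_countType (T := nat) ik (fun n _ => gk n).
  have [//|[lk|kl]] := ordinal_ltP ol ok.
    rewrite -lk in ek; have /inl[n en] := ek.
    by case: (mem_asym en (he n I)).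
  by have /inl[n kn] := kl; case: (mem_asym kn (gk n)).
have Rl x : x ∈ R l <-> exists n, x ∈ R (g n).
  split=> [/mem_R[b [/inl[n bn] xb]]|[n /mem_R[b [bn xb]]]].
    by exists n; apply/mem_R; exists b.
  by apply/mem_R; exists b; split=> //; apply/inl; exists n.
have RlA x : x ∈ R l <-> srel A x (R l).
  rewrite Ar; split=> [xl|[]//]; split=> //; [|exact: R_mem].
  exact: (R_mono ok lk).
exists l; last by apply/inl; exists 0%N.
split=> //; elim=> [i j|i j|i|q IH|q IHq r IHr|q IH] s hs //=.
- by split=> [[_ [_]]|].
- by split=> [[]|].
- by rewrite IH.
- by rewrite IHq // IHr.
split=> [[x [/mem_vsep[xA xl] xq]]|[x [xA xq]]].
  by exists x; split=> //; apply/IH => // -[|i] /=.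
have [n hn] : exists n, forall i, i < fbound q -> s i ∈ R (g n).
  elim: (fbound q) => [|m [n hn]]; first by exists 0%N.
  have /RlA/Rl[n' sn'] := hs m.
  exists (maxn n n') => i; rewrite ltnS leq_eqVlt => /orP[/eqP->|/hn].
    by apply: gm sn'; rewrite leq_maxr.
  by apply: gm; rewrite leq_maxl.
pose t i := if i < fbound q then s i else d.
have tq y : sat A q (scons y s) <-> sat A q (scons y t).
  apply: sat_fbound => -[//|i] /ltnW iq; rewrite /= /t iq //.
have [_ _ hg] := hF _ (gk n).
have [||y [yn yq]] := hg q t.
- split=> [i|]; rewrite /t.
    case: ifP => [/hn//|_]; apply: (gm 0%N n) => //.
    exact: R_mem.
  by exists (fbound q) => i; rewrite ltnNge => ->.
- by exists x; split=> //; apply/tq.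
have yl : srel A y (R l) by apply/RlA/Rl; exists n.+1.
exists y; split; first by apply/mem_vsep; split=> //; case: (srel_carrier yl).
by apply/IH; [case|apply/tq].
Qed.

(** * Levels as a first-order notion *)

(** The single unary predicate of the language carries a symmetric binary relation:
    the unordered pairs that satisfy it. *)
Definition code (A : structure) (x y : V) : Prop :=
  exists p, spred A p /\
    forall z, z ∈ carrier A -> (srel A z p <-> z = x \/ z = y).

(** Membership orients the unordered pairs: [u] is the level of index [b]. *)
Definition level (A : structure) (b u : V) : Prop := code A b u /\ srel A b u.

(** The unary predicate carried by the diagonal of [code]. *)
Program Definition decode (A : structure) : structure :=
  {| carrier := carrier A;
     srel := srel A;
     spred := fun x => x ∈ carrier A /\ code A x x |}.
Next Obligation. by move=> A x y; apply: srel_carrier. Qed.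
Next Obligation. by move=> A x []. Qed.

(** Each clause is expressible by first-order sentences about [A], the last one
    by one sentence for each formula; [levelled_elementary] rests on this. *)
Definition levelled (A : structure) : Prop :=
  [/\ forall b, b ∈ carrier A -> exists u, level A b u,
      forall b c u v, level A b u -> level A c v -> srel A b c -> srel A u v,
      forall b u x y, level A b u -> srel A y u -> srel A x y -> srel A x u &
      forall b u, level A b u -> reflects (decode A) u].

Definition FOr p q := FNot (FAnd (FNot p) (FNot q)).
Definition FImp p q := FNot (FAnd p (FNot q)).
Definition FIff p q := FAnd (FImp p q) (FImp q p).
Definition FAll p := FNot (FEx (FNot p)).

Lemma sat_or A p q s : sat A (FOr p q) s <-> sat A p s \/ sat A q s.
Proof.
split=> /= [h|h [np nq]]; last by case: h.
by apply: contrapT => n; apply: h; split=> ?; apply: n; [left|right].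
Qed.

Lemma sat_imp A p q s : sat A (FImp p q) s <-> (sat A p s -> sat A q s).
Proof.
split=> /= [h hp|h [hp]]; last by apply; apply: h.
by apply: contrapT => n; apply: h.
Qed.

Lemma sat_iff A p q s : sat A (FIff p q) s <-> (sat A p s <-> sat A q s).
Proof.
have -> : sat A (FIff p q) s <-> sat A (FImp p q) s /\ sat A (FImp q p) s by [].
by rewrite !sat_imp.
Qed.

Lemma sat_all A p s :
  sat A (FAll p) s <-> forall x, x ∈ carrier A -> sat A p (scons x s).
Proof.
split=> /= [h x xA|h [x [xA]]]; last by apply; apply: h.
by apply: contrapT => n; apply: h; exists x.
Qed.

Definition FUPair i j :=
  FAll (FIff (FMem 0 1) (FOr (FEq 0 i.+2) (FEq 0 j.+2))).
Definition FCode i j := FEx (FAnd (FPred 0) (FUPair i j)).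
Definition FLevel i j := FAnd (FCode i j) (FMem i j).

Lemma sat_code A i j s : sat A (FCode i j) s <-> code A (s i) (s j).
Proof.
have -> : sat A (FCode i j) s <-> exists p, p ∈ carrier A /\
  (spred A p /\ sat A (FUPair i j) (scons p s)) by [].
split=> [[p [pA [Sp h]]]|[p [Sp h]]]; exists p.
  by move/sat_all: h => h; split=> // z zA; have /sat_iff := h z zA; rewrite sat_or.
split; first exact: spred_carrier Sp.
split=> //; apply/sat_all => z zA; apply/sat_iff; rewrite sat_or; exact: h.
Qed.

Lemma sat_level A i j s : sat A (FLevel i j) s <-> level A (s i) (s j).
Proof.
have -> : sat A (FLevel i j) s <-> sat A (FCode i j) s /\ srel A (s i) (s j) by [].
by rewrite sat_code.
Qed.

(** Translation of statements about [decode A] into statements about [A]. *)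
Fixpoint decoded (p : formula) : formula :=
  match p with
  | FPred i => FCode i i
  | FNot q => FNot (decoded q)
  | FAnd q r => FAnd (decoded q) (decoded r)
  | FEx q => FEx (decoded q)
  | _ => p
  end.

(** Translation of statements about [restrict (decode A) u] into statements about
    [A], where [u] is the value of the variable [m]. Placing [u] at an index
    beyond the free variables of [p] avoids any renaming: a quantifier shifts
    [m] along with all other indices. *)
Fixpoint relativized (m : nat) (p : formula) : formula :=
  match p with
  | FEq i j => FEq i j
  | FMem i j => FAnd (FMem i m) (FAnd (FMem j m) (FMem i j))
  | FPred i => FAnd (FMem i m) (FCode i i)
  | FNot q => FNot (relativized m q)
  | FAnd q r => FAnd (relativized m q) (relativized m r)
  | FEx q => FEx (FAnd (FMem 0 m.+1) (relativized m.+1 q))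
  end.

Lemma scons_in (X : set V) x s : X x -> (forall i, X (s i)) ->
  forall i, X (scons x s i).
Proof. by move=> Xx Xs []. Qed.

Lemma sat_decoded A p s : (forall i, s i ∈ carrier A) ->
  sat (decode A) p s <-> sat A (decoded p) s.
Proof.
elim: p s => [i j|i j|i|q IH|q IHq r IHr|q IH] s sA //.
- by rewrite [decoded _]/= sat_code; split=> [[]|] //=; split.
- by rewrite /= IH.
- by rewrite /= IHq // IHr.
- have e x : x ∈ carrier A ->
      sat (decode A) q (scons x s) <-> sat A (decoded q) (scons x s).
    by move=> xA; apply: IH; apply: (scons_in (X := elts (carrier A))).
  by split=> -[x [xA /e h]]; exists x; split=> //; apply: h.
Qed.

Lemma sat_relativized A m p s : (forall i, s i ∈ carrier A) ->
  sat (restrict (decode A) (s m)) p s <-> sat A (relativized m p) s.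
Proof.
elim: p m s => [i j|i j|i|q IH|q IHq r IHr|q IH] m s sA //.
- rewrite [relativized _ _]/=.
  have -> : sat A (FAnd (FMem i m) (FCode i i)) s <->
    srel A (s i) (s m) /\ sat A (FCode i i) s by [].
  by rewrite sat_code /=; split=> [[? []]|[]].
- by rewrite /= IH.
- by rewrite /= IHq // IHr.
- have e x : x ∈ carrier A -> sat (restrict (decode A) (s m)) q (scons x s) <->
      sat A (relativized m.+1 q) (scons x s).
    by move=> xA; apply: (IH m.+1); apply: (scons_in (X := elts (carrier A))).
  split=> [[x [/mem_vsep[xA xm] /e h]]|[x [xA [xm /e h]]]]; exists x.
    by split=> //; split=> //; apply: h.
  by split; [apply/mem_vsep|apply: h].
Qed.

Lemma sat_exN A n p s : sat A (iter n FEx p) s <-> exists t,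
  [/\ forall i, i < n -> t i ∈ carrier A, forall i, t (n + i) = s i & sat A p t].
Proof.
elim: n s => [|n IH] s /=.
  split=> [h|[t [_ ts h]]]; first by exists s.
  by have <- : t = s by apply/funext.
split=> [[x [xA /IH[t [tA ts pt]]]]|[t [tA ts pt]]].
  exists t; split=> // i; last by rewrite addSnnS ts.
  rewrite ltnS leq_eqVlt => /orP[/eqP->|/tA//].
  by rewrite -(addn0 n) ts.
exists (t n); split; first exact: tA.
apply/IH; exists t; split=> // [i ni|[|i]]; first by apply: tA; apply: ltnW.
  by rewrite addn0.
by rewrite -addSnnS ts.
Qed.

(** A counterexample in [B] makes an existential closure of [FNot p] true in [B].
    This closure is a sentence, so its truth may be evaluated at an
    assignment in [A] and transferred to [A]. *)
Lemma elementary_valid (A B : structure) (a : V) (p : formula) :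
  elementary_extension A B -> a ∈ carrier A ->
  (forall s, (forall i, s i ∈ carrier A) -> sat A p s) ->
  forall s, (forall i, s i ∈ carrier B) -> sat B p s.
Proof.
move=> [AB el] aA vA s sB; apply: contrapT => ns.
pose n := fbound p.
have bn : fbound (iter n FEx (FNot p)) = 0%N.
  have -> : fbound (iter n FEx (FNot p)) = n - n.
    by elim: {1 3}n => [|m IH]; rewrite ?subn0 //= IH subnS.
  by rewrite subnn.
have : sat B (iter n FEx (FNot p)) (fun=> a).
  apply/(@sat_fbound _ _ _ (fun i => s (n + i)%N)); first by rewrite bn.
  by apply/sat_exN; exists s.
move/el => /(_ (fun=> aA))/sat_exN[t [tA ta]]; apply; apply: vA => i.
by have [/tA//|/subnKC<-] := ltnP i n; rewrite ta.
Qed.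

Fixpoint FMems (n m : nat) : formula :=
  if n is n'.+1 then FAnd (FMem n' m) (FMems n' m) else FEq 0 0.

Lemma sat_mems A n m s :
  sat A (FMems n m) s <-> forall i, i < n -> srel A (s i) (s m).
Proof.
elim: n => [|n IH] //=; rewrite IH; split=> [[h0 h] i|h].
  by rewrite ltnS leq_eqVlt => /orP[/eqP->|/h].
by split=> [|i /ltnW]; apply: h.
Qed.

Lemma levelled_elementary (A B : structure) (a : V) :
  elementary_extension A B -> a ∈ carrier A -> levelled A -> levelled B.
Proof.
move=> el aA [h1 h2 h3 h4]; have tr := elementary_valid el aA.
have aB : a ∈ carrier B := el.1 _ aA.
split=> [b bB|b c u v bu cv bc|b u x y bu yu xy|b u bu p s su].
- have : sat B (FEx (FLevel 1 0)) (fun=> b).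
    apply: tr => // s sA; have [u bu] := h1 _ (sA 0%N).
    exists u; split; last exact/sat_level.
    by have [_ /srel_carrier[]] := bu.
  by move=> [u [_ /sat_level bu]]; exists u.
- have [_ /srel_carrier[bB uB]] := bu; have [_ /srel_carrier[cB vB]] := cv.
  have : sat B (FImp (FAnd (FLevel 0 1) (FAnd (FLevel 2 3) (FMem 0 2)))
      (FMem 1 3)) (scons b (scons u (scons c (fun=> v)))).
    apply: tr => [s sA|[|[|[|i]]]] //.
    apply/sat_imp => -[/sat_level ? [/sat_level ?]].
    exact: h2.
  move/sat_imp; apply; split; first exact/sat_level.
  by split=> //; apply/sat_level.
- have [_ /srel_carrier[bB uB]] := bu; have [xB yB] := srel_carrier xy.
  have : sat B (FImp (FAnd (FLevel 0 1) (FAnd (FMem 2 1) (FMem 3 2)))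
      (FMem 3 1)) (scons b (scons u (scons y (fun=> x)))).
    apply: tr => [s sA|[|[|[|i]]]] //.
    by apply/sat_imp => -[/sat_level ? [yu' xy']]; apply: h3 xy'; eassumption.
  by move/sat_imp; apply; split; first exact/sat_level.
(* [t x v w] puts [v] and [w] at the indices [m] and [m.+1], just beyond the
   free variables of [p], where the reflection sentence expects the level and
   its index. *)
pose m := fbound p.
have [_ bu'] := bu; have [bB uB] := srel_carrier bu'.
pose t x v w i := if i < m then x i else if i == m then v else w : V.
have tm x v w : t x v w m = v by rewrite /t ltnn eqxx.
have tSm x v w : t x v w m.+1 = w by rewrite /t ltnNge leqnSn gtn_eqF.
have tE C x v w : sat C p (t x v w) <-> sat C p x.
  by apply: sat_fbound => i im; rewrite /t im.
have tB i : t s u b i ∈ carrier B.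
  by rewrite /t; case: ifP => _; [have [] := srel_carrier (su i)|case: ifP].
have : sat B (FImp (FAnd (FLevel m.+1 m) (FMems m m))
    (FIff (relativized m p) (decoded p))) (t s u b).
  apply: tr => // r rA; apply/sat_imp => -[/sat_level lr /sat_mems rm].
  apply/sat_iff; rewrite -sat_decoded // -sat_relativized //.
  rewrite -(tE _ r (r m.+1) (r m.+1)) -(tE (decode A) r (r m.+1) (r m.+1)).
  apply: (h4 _ _ lr) => i; rewrite /t; case: ifP => [/rm//|_].
  by rewrite if_same; case: lr.
move=> /sat_imp h.
have hm : sat B (relativized m p) (t s u b) <-> sat B (decoded p) (t s u b).
  apply/sat_iff/h; split; first by apply/sat_level; rewrite tm tSm.
  by apply/sat_mems => i im; rewrite tm /t im; apply: su.
rewrite -(tE _ s u b) -(tE (decode B) s u b) sat_decoded // -hm.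
by rewrite -{1}(tm s u b) sat_relativized.
Qed.

(** * The predicate coding the reflecting levels *)

Lemma structure_eq (A B : structure) : carrier A = carrier B ->
  (forall x y, srel A x y <-> srel B x y) ->
  (forall x, spred A x <-> spred B x) -> A = B.
Proof.
case: A => cA rA pA hrA hpA; case: B => cB rB pB hrB hpB /= ecar er ep.
have {}er : rA = rB by apply/funext => x; apply/funext => y; apply/propext.
have {}ep : pA = pB by apply/funext => x; apply/propext.
by case: _ / ecar in hrB hpB *; case: _ / er in hrB *; case: _ / ep in hpB *;
  congr Structure; apply: Prop_irrelevance.
Qed.

Definition vpair (x y : V) : V := vset (fun b : bool => if b then x else y).

Lemma mem_vpair x y z : z ∈ vpair x y <-> z = x \/ z = y.
Proof.
rewrite mem_vset; split=> [[[] ->]|[->|->]]; first by left.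
- by right.
- by exists true.
- by exists false.
Qed.

Lemma rank_mem x y : x ∈ y -> rank x ∈ rank y.
Proof. by move=> xy; apply/mem_rank; exists x; split=> //; right. Qed.

Lemma rank_ordinal x : is_ordinal x -> rank x = x.
Proof.
elim/(well_founded_ind mem_wf): x => x IH ox; apply: vext => u; rewrite mem_rank.
split=> [[y [yx]]|ux]; last first.
  by exists u; split=> //; right; rewrite IH //; apply: ordinal_mem ux.
rewrite IH //; last exact: ordinal_mem yx.
by case=> [uy|->//]; apply: ox.1 uy.
Qed.

Lemma R_ordinal k x : is_ordinal k -> is_ordinal x -> x ∈ R k <-> x ∈ k.
Proof. by move=> ok ox; rewrite mem_R_rank // rank_ordinal. Qed.

Lemma R_vpair k x y : inaccessible k -> x ∈ R k -> y ∈ R k -> vpair x y ∈ R k.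
Proof.
move=> ik /(mem_R_rank _ ik.1.1) xk /(mem_R_rank _ ik.1.1) yk.
have [d [dk xd yd]] := join_ordinal ik xk yk.
apply/mem_R; exists d; split=> // z /mem_vpair zxy.
by apply/mem_R_rank; [apply: ordinal_mem ik.1.1 dk|case: zxy => ->].
Qed.

(** Membership orients a pair [{b, U b}] since [b ∈ U b], and the pairs [{x, x}]
    cannot be confused with these since no set is an element of itself. The
    last clause says that the levels of the ordinals below [k] exhaust [R k];
    it puts [R k] inside the level of any index above these ordinals. *)
Lemma exists_levelled (k S : V) : inaccessible k -> S ⊆ R k -> exists T : V,
  let A := mem_structure (R k) T in
  [/\ T ⊆ R k, decode A = mem_structure (R k) S, levelled A &
      forall x, x ∈ R k -> exists b u, [/\ b ∈ k, level A b u & x ∈ u]].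
Proof.
move=> ik SR; have ok := ik.1.1.
have [|e he] := unbounded_enum ik (A := [set l | l ∈ k /\
    reflects (mem_structure (R k) S) (R l)]).
  by apply: unbounded_reflects => // x y; split=> [[? []]|[]].
pose U b := R (e (rank b)).
have rk b : b ∈ R k -> rank b ∈ k by move=> /(mem_R_rank _ ok).
have oe b : b ∈ k -> is_ordinal (e b).
  by move=> bk; have [[ek _] _ _] := he b bk; apply: ordinal_mem ek.
have UR b : b ∈ R k -> U b ∈ R k.
  by move=> /rk bk; have [[ek _] _ _] := he _ bk; apply: R_mem.
have bU b : b ∈ R k -> b ∈ U b.
  by move=> /rk bk; have [_ bb _] := he _ bk; apply/mem_R_rank => //; apply: oe.
pose T := vsep (R k) (fun p => (exists x, x ∈ S /\ p = vpair x x) \/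
  exists b, b ∈ R k /\ p = vpair b (U b)).
have cT x y : x ∈ R k -> y ∈ R k -> code (mem_structure (R k) T) x y <->
    (x = y /\ x ∈ S) \/
    exists b, b ∈ R k /\ forall z, z = b \/ z = U b <-> z = x \/ z = y.
  move=> xR yR; split=> [[p [[pR /mem_vsep[_ pT]] pxy]]|].
    have {}pxy z : z ∈ p <-> z = x \/ z = y.
      split=> [zp|zxy].
        have zR : z ∈ R k by apply: R_trans pR zp.
        by apply/(pxy z zR).
      have zR : z ∈ R k by case: zxy => ->.
      by have [_ []] := (pxy z zR).2 zxy.
    case: pT => [[c [cS pc]]|[b [bR pb]]].
      have ec z : z = x \/ z = y -> z = c.
        by rewrite -pxy pc mem_vpair => -[].
      have xc : x = c by apply: ec; left.
      have yc : y = c by apply: ec; right.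
      by left; rewrite xc yc.
    by right; exists b; split=> // z; rewrite -mem_vpair -pb.
  case=> [[<- xS]|[b [bR hb]]].
    exists (vpair x x); split=> [|z zR /=]; last by rewrite mem_vpair;
      split=> [[_ [_]]//|h]; do 2?split=> //; apply: R_vpair.
    by split; [apply: R_vpair|apply/mem_vsep; split; [apply: R_vpair|left; exists x]].
  have pR : vpair b (U b) ∈ R k by apply: R_vpair => //; apply: UR.
  exists (vpair b (U b)); split=> [|z zR /=].
    by split=> //; apply/mem_vsep; split=> //; right; exists b.
  by rewrite -hb -mem_vpair; split=> [[_ [_]]|].
have cxx x : x ∈ R k -> code (mem_structure (R k) T) x x <-> x ∈ S.
  move=> xR; rewrite cT //; split=> [[[]//|[b [bR hb]]]|]; last by left.
  have [b1 b2] : b = x /\ U b = x.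
    by split; [case: (hb b).1|case: (hb (U b)).1] => //; [left|right].
  by have := bU b bR; rewrite b2 b1 => /mem_irr.
have lT b u : level (mem_structure (R k) T) b u <-> b ∈ R k /\ u = U b.
  split=> [[bu [bR [uR ib]]]|[bR ->]]; last first.
    split; last by split=> //; split; [apply: UR|apply: bU].
    by apply/cT => //; [apply: UR|right; exists b].
  split=> //; case/cT: bu => // [[bu _]|[c [cR hc]]].
    by rewrite bu in ib; case: (mem_irr ib).
  have cU := bU c cR.
  have [cb|cu] : c = b \/ c = u by apply/hc; left.
    have [Ub|Uu] : U c = b \/ U c = u by apply/hc; right.
      by rewrite Ub cb in cU; case: (mem_irr cU).
    by rewrite -Uu cb.
  have [Ub|Uu] : U c = b \/ U c = u by apply/hc; right.
    by rewrite Ub cu in cU; case: (mem_asym cU ib).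
  by rewrite Uu cu in cU; case: (mem_irr cU).
have dT : decode (mem_structure (R k) T) = mem_structure (R k) S.
  apply: structure_eq => //= x.
  by split=> [[xR /(cxx x xR)]|[xR xS]] //; split=> //; apply/cxx.
exists T; split=> // [x /mem_vsep[]//||x xR]; last first.
  have xk := rk x xR; have ox := ordinal_rank x.
  have [_ xx _] := he _ xk.
  exists (rank x), (U (rank x)); split=> //.
    by apply/lT; split=> //; apply/R_ordinal.
  by rewrite /U rank_ordinal //; apply/mem_R_rank => //; apply: oe.
split=> [b bR|b c u v|b u x y|b u].
- by exists (U b); apply/lT.
- move=> /lT[bR ->] /lT[cR ->] [_ [_ bc]]; do 2?split; try exact: UR.
  have [_ _ h] := he _ (rk _ cR).
  by apply: R_mem; apply: h; apply: rank_mem.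
- move=> /lT[bR ->] [yR [_ yU]] [xR [_ xy]]; split=> //; split; first exact: UR.
  exact: (R_trans (oe _ (rk _ bR)) yU xy).
- by move=> /lT[bR ->]; rewrite dT; have [[]] := he _ (rk _ bR).
Qed.

(** * Chains *)

(** The recursive equation of the ordinal sum [k + x], as a function of [x]. *)
Lemma ordinal_add (k : V) :
  exists add : V -> V, forall x u,
    u ∈ add x <-> u ∈ k \/ exists y, y ∈ x /\ u = add y.
Proof.
have [add h] := wf_choice k (fun _ D a => forall u, u ∈ a <-> u ∈ k \/ D u).
exists add => x u.
pose g (o : idx k + idx x) :=
  match o with inl i => elt i | inr i => add (elt i) end.
have {}h : forall u, u ∈ add x <-> u ∈ k \/ (add @` elts x) u.
  apply: (h x).
  exists (vset g) => v; rewrite mem_vset; split=> [[[i|i] ->]|].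
  - by left; exists i.
  - by right; exists (elt i) => //; exists i.
  - move=> [[i ->]|[y [i ->] <-]]; first by exists (inl i).
    by exists (inr i).
split=> [/h[uk|[y yx <-]]|uxk]; [by left|by right; exists y|apply/h].
by case: uxk => [|[y [yx ->]]]; [left|right; exists y].
Qed.

Lemma ordinal_add_ordinal (k x : V) (add : V -> V) :
  (forall x u, u ∈ add x <-> u ∈ k \/ exists y, y ∈ x /\ u = add y) ->
  is_ordinal k -> is_ordinal x -> is_ordinal (add x).
Proof.
move=> hadd ok; elim/(well_founded_ind mem_wf): x => x IH ox.
have o u : u ∈ add x -> is_ordinal u.
  move=> /hadd[uk|[y [yx ->]]]; first exact: ordinal_mem uk.
  by apply: IH => //; apply: ordinal_mem yx.
split=> [u v ux vu|u v /o ou /o ov]; last exact: ordinal_ltP.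
apply/hadd; case/hadd: ux => [uk|[y [yx uy]]].
  by left; apply: ok.1 uk vu.
move: vu; rewrite uy => /hadd[vk|[z [zy ->]]]; first by left.
by right; exists z; split=> //; apply: ox.1 zy.
Qed.

(** End extensions give no new elements to a member of [R k], and [R k] is
    transitive. *)
Lemma end_extension_R (k T x y : V) (M : structure) : is_ordinal k ->
  end_extension (mem_structure (R k) T) M -> y ∈ R k -> srel M x y <-> x ∈ y.
Proof.
move=> ok [sub ext] yR; have /seteqP[h1 h2] := ext y yR.
split=> xy; first by have [_ [_ []]] := h2 x (conj (srel_carrier xy).1 xy).
have xR : x ∈ R k by apply: R_trans xy.
by have [] := h1 x (conj xR (conj xR (conj yR xy))).
Qed.

Lemma end_extension_ordinal (k T x : V) (M : structure) : is_ordinal k ->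
  end_extension (mem_structure (R k) T) M -> x ∈ R k ->
  ordinal_for (srel M) x <-> is_ordinal x.
Proof.
move=> ok ext xR; have E u v (vR : v ∈ R k) := end_extension_R u ok ext vR.
have tr y : y ∈ x -> y ∈ R k by apply: R_trans.
have Ex y : srel M y x <-> y ∈ x by apply: E.
split=> -[h1 h2]; split=> y z.
- move=> yx zy; apply/Ex; apply: (h1 y); first exact/Ex.
  by apply/E => //; apply: tr.
- move=> yx zx; have yR := tr _ yx; have zR := tr _ zx.
  by have := h2 y z ((Ex y).2 yx) ((Ex z).2 zx); rewrite (E y z zR) (E z y yR).
- move=> /Ex yx /(E _ _ (tr _ yx)) zy; apply/Ex; exact: h1 yx zy.
- move=> /Ex yx /Ex zx; have yR := tr _ yx; have zR := tr _ zx.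
  by rewrite (E y z zR) (E z y yR); apply: h2.
Qed.

(** The ordinals of [M] lying in [R k] are true ordinals and form an initial segment
    of the ordinals of [M]; an isomorphism between initial segments of the
    ordinals is the identity. *)
Lemma height_fixes_R (k T t c : V) (M : structure) (f : V -> V) :
  is_ordinal k -> end_extension (mem_structure (R k) T) M -> is_ordinal t ->
  set_bij (elts t) (ordinals M) f ->
  (forall x y, x ∈ t -> y ∈ t -> (x ∈ y <-> srel M (f x) (f y))) ->
  c ∈ t -> f c ∈ R k -> f c = c.
Proof.
move=> ok ext ot [ffun _ fsurj] fmono.
elim/(well_founded_ind mem_wf): c => c IH ct fcR.
have [sub _] := ext; have E u v (vR : v ∈ R k) := end_extension_R u ok ext vR.
have oc : is_ordinal (f c).
  by apply/(end_extension_ordinal ok ext fcR); case: (ffun _ ct).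
apply: vext => u; split=> uc.
  have uR : u ∈ R k by apply: R_trans uc.
  have [|d dt du] := fsurj u.
    split; first exact: sub.
    by apply/(end_extension_ordinal ok ext uR); apply: ordinal_mem uc.
  have dc : d ∈ c by apply/fmono => //; rewrite du; apply/E.
  by rewrite -du IH // du.
have ut : u ∈ t by apply: ot.1 uc.
have fuc : f u ∈ f c by apply/E => //; apply/fmono.
by rewrite -(IH u) //; apply: R_trans fuc.
Qed.

(** Both levels are elementary in [M], so the smaller one is elementary in the larger
    one; transitivity of levels makes the extension an end extension, and
    well-foundedness makes it proper. *)
Lemma prec_e_level (M : structure) (b c u v : V) :
  levelled M -> wf_structure M -> level M b u -> level M c v -> srel M b c ->
  restrict (decode M) u ≺ₑ restrict (decode M) v.
Proof.
move=> [_ h2 h3 h4] wfM bu cv bc; have uv := h2 _ _ _ _ bu cv bc.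
have lift x : srel M x u -> srel M x v by move=> xu; apply: h3 cv uv xu.
have sub : carrier (restrict (decode M) u) ⊆ carrier (restrict (decode M) v).
  by move=> x /mem_vsep[xM /lift xv]; apply/mem_vsep.
split; first split=> // x /mem_vsep[xM xu].
- apply/seteqP; split=> y [ym [yu [_ yx]]].
    by split; [apply: sub|split; [apply: lift|split; [apply: lift|]]].
  have yu' : srel M y u by apply: h3 bu xu yx.
  by split=> //; apply/mem_vsep; split=> //; case/mem_vsep: ym.
- move=> e; have irr : forall x, ~ srel M x x.
    elim/(well_founded_ind wfM) => x IH xx; exact: (IH x xx xx).
  have : u ∈ carrier (restrict (decode M) v).
    by apply/mem_vsep; split=> //; have [] := srel_carrier uv.
  by rewrite -e => /mem_vsep[_ /irr].
- split=> // p s su.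
  have su' i : srel M (s i) u by have /mem_vsep[] := su i.
  by rewrite (h4 _ _ bu) // (h4 _ _ cv) // => i; apply: lift.
Qed.

(** Here properness comes from the index [b], which belongs to its level [u] but not
    to [A]. *)
Lemma prec_e_base (A M : structure) (b u : V) : levelled M -> A ≺ₑ M ->
  level M b u -> ~ b ∈ carrier A -> (forall x, x ∈ carrier A -> srel M x u) ->
  decode A ≺ₑ restrict (decode M) u.
Proof.
move=> [_ h2 h3 h4] [[sAM ext] _ [_ el]] bu bA Au.
have sub : carrier A ⊆ carrier (restrict (decode M) u).
  by move=> x xA; apply/mem_vsep; split; [apply: sAM|apply: Au].
split; first split=> // x xA.
- have /seteqP[e1 e2] := ext x xA; apply/seteqP; split=> y [yc yx].
    have [_ yx'] := e1 y (conj yc yx).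
    by split; [apply: sub|split; [apply: Au|split; [apply: Au|]]].
  have [_ [_ yx']] := yx.
  by apply: e2; split=> //; case/mem_vsep: yc.
- move=> /= e; apply: bA; rewrite e; apply/mem_vsep; case: bu => _ bu.
  by split=> //; case: (srel_carrier bu).
- split=> // p s sA.
  have sM i : s i ∈ carrier M by apply: sAM; apply: sA.
  rewrite (h4 _ _ bu) => [|i]; last by apply: Au; apply: sA.
  by rewrite !sat_decoded // el.
Qed.

Theorem proposition1p1 (k : V) (hk : unfoldable k) (S : V) (hS : S ⊆ R k)
    (a : V) (ha : is_ordinal a) :
  contains_chain (eee_wf (mem_structure (R k) S)) prec_e a.
Proof.
have [ik uk] := hk; have ok := ik.1.1.
have [T [TR dT lA cover]] := exists_levelled ik hS.
have [add hadd] := ordinal_add k.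
have oadd x : is_ordinal x -> is_ordinal (add x) by apply: ordinal_add_ordinal.
have [M [AM [wfM [t [[ot [f [fbij fmono]]] at_]]]]] := uk (add a) T (oadd a ha) TR.
have [ext _ el] := AM; have [ffun _ fsurj] := fbij.
have [c0 c0k] := inaccessible_neq0 ik.
have lM : levelled M by apply: levelled_elementary el (R_mem c0k) lA.
have addt x : x ∈ a -> add x ∈ t.
  move=> xa; have axa : add x ∈ add a by apply/hadd; right; exists x.
  by case: at_ => [h|<-//]; apply: ot.1 axa.
have fixR c : c ∈ t -> f c ∈ R k -> f c = c.
  exact: height_fixes_R ok ext ot fbij fmono.
have outside x : x ∈ a -> ~ f (add x) ∈ R k.
  move=> xa fR; have oax := oadd x (ordinal_mem ha xa).
  have : add x ∈ add x; last exact: mem_irr.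
  by apply/hadd; left; apply/(R_ordinal ok oax); rewrite -(fixR _ (addt x xa) fR).
(* [u x] is a level of [M] whose index is the ordinal number [k + x] of [M]. *)
have /choice[u hu] : forall x, exists u, x ∈ a -> level M (f (add x)) u.
  move=> x; have [xa|] := pselect (x ∈ a); last by exists a.
  have [fM _] := ffun _ (addt x xa); have [h1 _ _ _] := lM.
  by have [u ?] := h1 _ fM; exists u.
have above x d : x ∈ a -> d ∈ k -> srel M d (f (add x)).
  move=> xa dk; have od := ordinal_mem ok dk.
  have dR : d ∈ R k by apply/R_ordinal.
  have [|d' d't fd'] := fsurj d.
    by split; [apply: ext.1|apply/(end_extension_ordinal ok ext dR)].
  have d'd : d = d' by rewrite -fd' fixR // fd'.
  rewrite -{1}fd' -d'd; apply/fmono; rewrite ?d'd //; first exact: addt.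
  by apply/hadd; left; rewrite -d'd.
have coverM x y : x ∈ a -> y ∈ R k -> srel M y (u x).
  move=> xa yR; have [d [v [dk [dv [dR [vR dv']]] yv]]] := cover y yR.
  have dvM : level M d v.
    pose s := scons d (fun=> v).
    have sR i : s i ∈ R k by case: i.
    have /(el.2 _ _ sR)/sat_level : sat (mem_structure (R k) T) (FLevel 0 1) s.
      by apply/sat_level.
    by [].
  have [_ h2 h3 _] := lM; have vu := h2 _ _ _ _ dvM (hu x xa) (above x d xa dk).
  by apply: h3 (hu x xa) vu _; apply/(end_extension_R _ ok ext).
pose G x := restrict (decode M) (u x).
have Gmono x y : x ∈ a -> y ∈ a -> x ∈ y -> G x ≺ₑ G y.
  move=> xa ya xy; apply: prec_e_level (hu x xa) (hu y ya) _ => //.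
  by apply/fmono; [exact: addt|exact: addt|apply/hadd; right; exists x].
have anti A B : A ≺ₑ B -> carrier B ⊆ carrier A -> False.
  move=> [[AB _] nAB _] BA; apply: nAB; apply: vext => z.
  by split=> [/AB|/BA].
exists (G @` elts a); split=> [_ [x xa <-]|].
  split; last first.
    move=> z; elim/(well_founded_ind wfM): z => z IH.
    by constructor=> y [_ [_ yz]]; apply: IH.
  rewrite /eee /= -dT; apply: (prec_e_base lM AM (hu x xa) (outside x xa)).
  by move=> y; apply: coverM.
exists G; split; last first.
  move=> x y xa ya; split; first exact: Gmono.
  move=> Gxy; have [//|[xy|yx]] := ha.2 x y xa ya.
    by case: Gxy => _ []; rewrite xy.
  by case: (anti _ _ (Gmono y x ya xa yx)); case: Gxy => -[].
split=> [x xa|x y /set_mem xa /set_mem ya Gxy|//]; first by exists x.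
have [xy|[//|yx]] := ha.2 x y xa ya.
  by case: (anti _ _ (Gmono x y xa ya xy)); rewrite Gxy.
by case: (anti _ _ (Gmono y x ya xa yx)); rewrite Gxy.
Qed.
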